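(* Let $\|\cdot\|$ be a convex functional, and let the operators $G$ and $\dot G$, where $\dot G(u)=G'(u)G(u)$, satisfy, for some $\Delta t_{\mathrm{FE}}>0$ and $\dot k>0$, the forward Euler condition $$\|u+\Delta t\,G(u)\|\le \|u\|\quad\text{for all } u \text{ and all } 0<\Delta t\le \Delta t_{\mathrm{FE}},$$ and the backward derivative condition $$\|u-\Delta t^2\,\dot G(u)\|\le\|u\|\quad\text{for all } u \text{ and all } \Delta t>0 \text{ with } \Delta t^2\le \dot k\,\Delta t_{\mathrm{FE}}^2 .$$ Consider an $s$-stage implicit two-derivative Runge--Kutta method for $u_t=G(u)$ of the form $$u^{(i)}=r_i u^n+\sum_{j=1}^{i-1}p_{ij}u^{(j)}+\Delta t\, d_{ii}G(u^{(i)})+\Delta t^2\,\dot d_{ii}\,\dot G(u^{(i)}),\quad i=1,\dots,s,\qquad u^{n+1}=u^{(s)},$$ with coefficient matrices $\mathbf P=(p_{ij})$, $\mathbf R=I-\mathbf P$, $\mathbf D=\mathrm{diag}(d_{ii})$, $\dot{\mathbf D}=\mathrm{diag}(\dot d_{ii})$ and $r_i=(\mathbf R\mathbf e)_i$. If the method satisfies, componentwise, $$\mathbf R\mathbf e\ge 0,\qquad \mathbf P\ge 0,\qquad \mathbf D\ge 0,\qquad \dot{\mathbf D}\le 0,$$ then it preserves the strong stability property $$\|u^{n+1}\|\le\|u^n\|$$ for any positive time-step $\Delta t>0$.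
   Context: The ODE system is $u_t=G(u)$ with $G$ a differentiable operator on the (finite-dimensional real) state space, and $\dot G=\frac{dG}{dt}=G'G$, i.e. $\dot G(u)=G'(u)G(u)$. The matrices $\mathbf P,\mathbf R,\mathbf D,\dot{\mathbf D}$ are real $s\times s$ matrices: $\mathbf P$ is strictly lower triangular, $\mathbf R=I-\mathbf P$, and $\mathbf D,\dot{\mathbf D}$ are diagonal; $\mathbf e\in\mathbb R^s$ is the vector of ones, so $r_i$ is the $i$th row sum of $\mathbf R$ and $r_i+\sum_{j<i}p_{ij}=1$. In matrix form the method reads $U=\mathbf R\mathbf e\,u^n+\mathbf P U+\Delta t\,\mathbf D G(U)+\Delta t^2\,\dot{\mathbf D}\,\dot G(U)$ with $U=(u^{(1)},\dots,u^{(s)})$. The stage equations are implicit; the claim concerns stage values $u^{(1)},\dots,u^{(s)}$ satisfying them. *)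

(* Defs.v *)
From HB Require Import structures.
From mathcomp Require Import all_boot all_order all_algebra.
From mathcomp Require Import reals classical_sets topology normedtype derive convex.
Import numFieldNormedType.Exports.

Set Implicit Arguments.
Unset Strict Implicit.
Unset Printing Implicit Defensive.

Import Order.TTheory GRing.Theory Num.Theory.
Local Open Scope classical_set_scope.
Local Open Scope ring_scope.

(* The states are row vectors, and [phi] is the convex functional ||.||.  It is
   unrelated to the norm of 'rV[R]_m, which only serves to define 'd G. *)

Section Operators.
Context {R : realType} {m : nat}.
Implicit Types (phi : 'rV[R]_m -> R) (G : 'rV[R]_m -> 'rV[R]_m).

Definition convex_functional phi : Prop :=
  @convex_function R 'rV[R]_m [set: 'rV[R]_m] phi.

(* Time derivative of G along the solutions of u_t = G(u): G'(u) G(u). *)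
Definition Gdot G (u : 'rV[R]_m) : 'rV[R]_m := 'd G u (G u).

Definition forward_euler phi G (dtFE : R) : Prop :=
  forall (u : 'rV[R]_m) (dt : R), 0 < dt -> dt <= dtFE ->
    phi (u + dt *: G u) <= phi u.

Definition backward_derivative phi G (dtFE kdot : R) : Prop :=
  forall (u : 'rV[R]_m) (dt : R), 0 < dt -> dt ^+ 2 <= kdot * dtFE ^+ 2 ->
    phi (u - dt ^+ 2 *: Gdot G u) <= phi u.

End Operators.

(* MathComp's is_trig_mx allows a nonzero diagonal. *)
Definition strictly_lower {R : realType} {s : nat} (P : 'M[R]_s) : Prop :=
  forall i j : 'I_s, (i <= j)%N -> P i j = 0.

Section Method.
Context {R : realType} {m s : nat}.

Definition Rmat (P : 'M[R]_s) : 'M[R]_s := 1%:M - P.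

(* A e, with e the vector of ones. *)
Definition row_sums (A : 'M[R]_s) : 'cV[R]_s := A *m const_mx 1.

Definition stage_equations (G : 'rV[R]_m -> 'rV[R]_m) (P D Ddot : 'M[R]_s)
    (dt : R) (un : 'rV[R]_m) (U : 'I_s -> 'rV[R]_m) : Prop :=
  forall i : 'I_s,
    U i = row_sums (Rmat P) i ord0 *: un
          + (\sum_(j < s | (j < i)%N) P i j *: U j)
          + (dt * D i i) *: G (U i)
          + (dt ^+ 2 * Ddot i i) *: Gdot G (U i).

End Method.

(* One step of the method with s.+1 stages, of which ord_max is the last. *)
Definition method_step {R : realType} {m s : nat}
    (G : 'rV[R]_m -> 'rV[R]_m) (P D Ddot : 'M[R]_s.+1) (dt : R)
    (un : 'rV[R]_m) (U : 'I_s.+1 -> 'rV[R]_m) (unext : 'rV[R]_m) : Prop :=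
  stage_equations G P D Ddot dt un U /\ unext = U ord_max.

(* Main.v *)
Require Import Defs.
From HB Require Import structures.
From mathcomp Require Import all_boot all_order all_algebra.
From mathcomp Require Import reals classical_sets topology normedtype derive convex.
From mathcomp Require Import interval_inference ring.
Import numFieldNormedType.Exports.
Import Order.TTheory GRing.Theory Num.Theory.
Local Open Scope ring_scope.

(** Each stage is written as [u = w + a *: G u + b *: Gdot G u], where
    [0 <= a], [b <= 0], and [w] is the explicit part, a convex combination of
    [un] and of the earlier stages.  Two convexity arguments give the bound.

    First, [phi u <= phi w], whatever the size of [a] and [b].  Solving for
    [w] gives [w = u - a *: G u - b *: Gdot G u]: the displacement from [u] to
    [w] is a nonpositive combination of those from [u] to [u + dtFE *: G u]
    and to [u - kappa *: Gdot G u], where [kappa = kdot * dtFE ^+ 2].  So [u]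
    is a convex combination of [w] and of these two points, with a positive
    weight on [w].  At both of these points [phi]
    is at most [phi u], and Jensen's inequality reads
    [phi u <= c * phi w + (1 - c) * phi u] with [c > 0]
    ([convex_implicit_step], [convex_stage]).  Implicitness is what removes
    any restriction on the time step: the step only changes [c].

    Second, [phi w <= phi un] by Jensen's inequality again, once the earlier
    stages are known to satisfy [phi (U j) <= phi un]; strong induction on the
    stage index concludes ([convex_stages]). *)

Section Jensen.
Context {R : numFieldType} {E : lmodType R} {phi : E -> R}.
Hypothesis phi_convex : @convex_function R E [set: E] phi.

Lemma convex_pair {a b : R} (x y : E) : 0 <= a -> 0 <= b -> a + b = 1 ->
  phi (a *: x + b *: y) <= a * phi x + b * phi y.
Proof.
move=> a0 b0 ab1; have a1 : a <= 1 by rewrite -ab1 lerDl.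
have := phi_convex (Itv01 a0 a1) _ _ (mem_setT x) (mem_setT y).
have -> : b = 1 - a by rewrite -ab1 addrC addKr.
exact.
Qed.

(** A positive weight set apart is what makes the induction go through: merging
    it with the next point divides by the sum of their weights. *)
Lemma jensen_head (r : seq (R * E)) (a : R) (x : E) : 0 < a ->
  (forall p, p \in r -> 0 <= p.1) -> a + \sum_(p <- r) p.1 = 1 ->
  phi (a *: x + \sum_(p <- r) p.1 *: p.2)
    <= a * phi x + \sum_(p <- r) p.1 * phi p.2.
Proof.
elim: r a x => [|[b y] r IHr] a x a_gt0 r_ge0.
  by rewrite !big_nil !addr0 => ->; rewrite scale1r mul1r.
rewrite !big_cons /= !addrA => sum1.
have b_ge0 : 0 <= b by apply: (r_ge0 (b, y)); rewrite mem_head.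
have ab_gt0 : 0 < a + b by rewrite ltr_pwDl.
have ab_neq0 : a + b != 0 by rewrite gt_eqF.
set z := (a / (a + b)) *: x + (b / (a + b)) *: y.
have -> : a *: x + b *: y = (a + b) *: z.
  by rewrite scalerDr !scalerA !(mulrC (a + b)) !divfK.
have phi_z : (a + b) * phi z <= a * phi x + b * phi y.
  have -> : a * phi x + b * phi y
      = (a + b) * (a / (a + b) * phi x + b / (a + b) * phi y).
    by field.
  rewrite ler_pM2l //; apply: convex_pair; last by rewrite -mulrDl divff.
  - by rewrite divr_ge0 // ltW.
  - by rewrite divr_ge0 // ltW.
apply: le_trans (lerD phi_z (lexx _)).
by apply: IHr => // p pr; apply: r_ge0; rewrite inE pr orbT.
Qed.

Lemma jensen (r : seq (R * E)) :
  (forall p, p \in r -> 0 <= p.1) -> \sum_(p <- r) p.1 = 1 ->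
  phi (\sum_(p <- r) p.1 *: p.2) <= \sum_(p <- r) p.1 * phi p.2.
Proof.
elim: r => [|[a x] r IHr] r_ge0.
  by rewrite big_nil => /esym/eqP; rewrite oner_eq0.
rewrite !big_cons /=.
have r'_ge0 p : p \in r -> 0 <= p.1.
  by move=> pr; apply: r_ge0; rewrite inE pr orbT.
have [->|a_neq0] := eqVneq a 0.
  by rewrite scale0r mul0r !add0r; apply: IHr.
apply: jensen_head => //; rewrite lt_def a_neq0.
by apply: (r_ge0 (a, x)); rewrite mem_head.
Qed.

(** Dividing by [1 + a + b] in
    [(1 + a + b) *: u = (u - a *: v - b *: z) + a *: (u + v) + b *: (u + z)]
    exhibits [u] as a convex combination; the terms in [phi u] that Jensen's
    inequality leaves on the right are then absorbed on the left. *)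
Lemma convex_implicit_step {u v z : E} {a b : R} :
  phi (u + v) <= phi u -> phi (u + z) <= phi u -> 0 <= a -> 0 <= b ->
  phi u <= phi (u - a *: v - b *: z).
Proof.
move=> phi_v phi_z a_ge0 b_ge0; set w := u - _ - _.
have s_gt0 : 0 < 1 + a + b by rewrite -addrA ltr_pwDl // addr_ge0.
have s_neq0 : 1 + a + b != 0 by rewrite gt_eqF.
pose c := (1 + a + b)^-1.
have c_gt0 : 0 < c by rewrite invr_gt0.
have cs : c + (c * a + c * b) = 1 by rewrite /c; field.
have uE : u = c *: w + (c * a *: (u + v) + c * b *: (u + z)).
  rewrite -!scalerA -!scalerDr -[LHS]scale1r -(mulVf s_neq0) -scalerA.
  congr (_ *: _); rewrite /w !scalerDr !scalerDl scale1r.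
  rewrite [X in _ = _ + X]addrACA -[u - _ - _]addrA -opprD.
  by rewrite [X in _ = _ + X]addrC [RHS]addrA subrK addrA.
have := jensen_head [:: (c * a, u + v); (c * b, u + z)] c w c_gt0.
rewrite !big_cons !big_nil /= !addr0 -uE => /(_ _ cs) phi_u.
have {}phi_u : phi u <= c * phi w + (c * a + c * b) * phi u.
  rewrite mulrDl; apply: le_trans (phi_u _) _.
    by move=> p; rewrite !inE => /orP[]/eqP-> /=; rewrite mulr_ge0 // ltW.
  by rewrite lerD2l lerD // ler_wpM2l // mulr_ge0 // ltW.
have csE : c * a + c * b = 1 - c by rewrite -cs [RHS]addrC addKr.
rewrite -(ler_pM2l c_gt0); move: phi_u; rewrite csE mulrBl mul1r.
by rewrite addrCA -[leLHS]addr0 lerD2l subr_ge0.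
Qed.

End Jensen.

Section Stages.
Context {R : realType} {m : nat}.
Context {phi : 'rV[R]_m -> R} {G : 'rV[R]_m -> 'rV[R]_m} {dtFE kdot : R}.
Hypothesis phi_convex : convex_functional phi.
Hypotheses (dtFE_gt0 : 0 < dtFE) (kdot_gt0 : 0 < kdot).
Hypothesis G_FE : forward_euler phi G dtFE.
Hypothesis G_BD : backward_derivative phi G dtFE kdot.

(** The coefficients enter only through the nonnegative weights [a / dtFE] and
    [- b / kappa], which [convex_implicit_step] accepts at any size. *)
Lemma convex_stage {u w : 'rV[R]_m} {a b : R} : 0 <= a -> b <= 0 ->
  u = w + a *: G u + b *: Gdot G u -> phi u <= phi w.
Proof.
move=> a_ge0 b_le0 uE.
(* The largest squared step that the backward derivative condition allows. *)
pose kappa := kdot * dtFE ^+ 2.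
have kappa_gt0 : 0 < kappa by rewrite mulr_gt0 // exprn_gt0.
have sqrt_kappa : Num.sqrt kappa ^+ 2 = kappa by rewrite sqr_sqrtr // ltW.
have phi_FE : phi (u + dtFE *: G u) <= phi u by apply: G_FE.
have phi_BD : phi (u - kappa *: Gdot G u) <= phi u.
  by have := G_BD u (Num.sqrt kappa); rewrite sqrt_kappa sqrtr_gt0; apply.
have a'_ge0 : 0 <= a / dtFE by rewrite divr_ge0 // ltW.
have b'_ge0 : 0 <= - b / kappa by rewrite divr_ge0 ?oppr_ge0 // ltW.
have := convex_implicit_step phi_convex phi_FE phi_BD a'_ge0 b'_ge0.
rewrite scalerN opprK !scalerA !divfK ?gt_eqF // scaleNr.
have -> // : u - a *: G u - b *: Gdot G u = w.
by rewrite [X in X - _ - _]uE addrAC addrK addrK.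
Qed.

(** By [R = I - P], the row sum of [R] and the entries of the same row of [P]
    add up to 1, and strict lower triangularity leaves only earlier stages with
    a nonzero weight: so the explicit part of a stage is a convex combination
    of [un] and of states already bounded. *)
Lemma convex_stages {s : nat} {P D Ddot : 'M[R]_s} {dt : R}
    {un : 'rV[R]_m} {U : 'I_s -> 'rV[R]_m} :
  strictly_lower P ->
  (forall i, 0 <= row_sums (Rmat P) i ord0) -> (forall i j, 0 <= P i j) ->
  (forall i, 0 <= D i i) -> (forall i, Ddot i i <= 0) -> 0 <= dt ->
  stage_equations G P D Ddot dt un U -> forall i, phi (U i) <= phi un.
Proof.
move=> P_lower Re_ge0 P_ge0 D_ge0 Ddot_le0 dt_ge0 U_eq i.
have [n] := ubnP (i : nat); elim: n i => // n IHn i; rewrite ltnS => le_in.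
have dtD_ge0 : 0 <= dt * D i i by rewrite mulr_ge0.
have dtDdot_le0 : dt ^+ 2 * Ddot i i <= 0.
  by rewrite mulr_ge0_le0 // exprn_ge0.
apply: le_trans (convex_stage dtD_ge0 dtDdot_le0 (U_eq i)) _.
have row_sum1 :
    row_sums (Rmat P) i ord0 + \sum_(j < s | (j < i)%N) P i j = 1.
  have -> : \sum_(j < s | (j < i)%N) P i j = row_sums P i ord0.
    rewrite big_mkcond mxE; apply: eq_bigr => j _; rewrite mxE mulr1.
    by case: ltnP => // /P_lower->.
  by rewrite /row_sums /Rmat mulmxBl mul1mx !mxE subrK.
pose r := (row_sums (Rmat P) i ord0, un)
  :: [seq (P i j, U j) | j : 'I_s <- enum 'I_s & (j < i)%N].
have r_ge0 p : p \in r -> 0 <= p.1.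
  by rewrite inE => /orP[/eqP->|/mapP[j _ ->]] /=.
have := jensen phi_convex r r_ge0.
rewrite !big_cons !big_map !big_filter !big_enum_cond /= => /(_ row_sum1).
move=> /le_trans; apply.
rewrite -[leRHS]mul1r -row_sum1 mulrDl lerD2l mulr_suml.
apply: ler_sum => j lt_ji; rewrite ler_wpM2l // IHn //.
exact: leq_trans lt_ji le_in.
Qed.

End Stages.

Theorem theorem1 (R : realType) (m s : nat)
    (phi : 'rV[R]_m -> R) (G : 'rV[R]_m -> 'rV[R]_m) (dtFE kdot : R)
    (P D Ddot : 'M[R]_s.+1)
    (phi_convex : convex_functional phi)
    (G_diff : forall u : 'rV[R]_m, differentiable G u)
    (dtFE_gt0 : 0 < dtFE) (kdot_gt0 : 0 < kdot)
    (G_FE : forward_euler phi G dtFE)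
    (G_BD : backward_derivative phi G dtFE kdot)
    (P_lower : strictly_lower P)
    (D_diag : is_diag_mx D) (Ddot_diag : is_diag_mx Ddot)
    (Re_ge0 : forall i, 0 <= row_sums (Rmat P) i ord0)
    (P_ge0 : forall i j, 0 <= P i j)
    (D_ge0 : forall i j, 0 <= D i j)
    (Ddot_le0 : forall i j, Ddot i j <= 0) :
  forall (dt : R) (un unext : 'rV[R]_m) (U : 'I_s.+1 -> 'rV[R]_m),
    0 < dt ->
    method_step G P D Ddot dt un U unext ->
    phi unext <= phi un.
Proof.
move=> dt un unext U dt_gt0 [U_eq ->].
apply: (convex_stages phi_convex dtFE_gt0 kdot_gt0 G_FE G_BD _ _ _ _ _ _ U_eq).
- exact: P_lower.
- exact: Re_ge0.
- exact: P_ge0.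
- by move=> i; apply: D_ge0.
- by move=> i; apply: Ddot_le0.
- exact: ltW.
Qed.
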